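(* Let $(A,\rho,\mathbb{B})$ be a complete local contact algebra (CLCA), $X=\Psi^a(A,\rho,\mathbb{B})$, $a_0\in A$ and $F=\lambda_A^g(a_0)$. Set $B=A|a_0$ and let $\varphi:A\to B$ be the natural epimorphism, i.e. $\varphi(a)=a\wedge a_0$ for every $a\in A$. Put $\mathbb{B}'=\varphi(\mathbb{B})$ and, for $a,b\in B$, let $a\,\eta\, b$ iff $a\,\rho\, b$. Then $(B,\eta,\mathbb{B}')$ is a CLCA. If $G=\Psi^a(B,\eta,\mathbb{B}')$ then $G$ is homeomorphic to $F$ and thus $\Psi^t(F)$ is isomorphic to $(B,\eta,\mathbb{B}')$. If $f=\Psi^a(\varphi)$ then $f:G\to X$ is a closed quasi-open injection and $f(G)=F$.
   Context: A local contact algebra (LCA) is a triple $(A,\rho,\mathbb{B})$, where $A$ is a Boolean algebra, $\rho$ is a binary relation on $A$ and $\mathbb{B}$ is an ideal of $A$ (possibly non-proper) such that, writing $a\ll_\rho b$ when $a\,\rho\, b^*$ fails: (C1) $a\ne 0$ implies $a\,\rho\, a$; (C2) $a\,\rho\, b$ implies $a\ne0$ and $b\neq 0$; (C3) $a\,\rho\, b$ implies $b\,\rho\, a$; (C4) $a\,\rho\,(b\vee c)$ iff $a\,\rho\, b$ or $a\,\rho\, c$; (BC1) if $a\in\mathbb{B}$, $c\in A$ and $a\ll_\rho c$ then $a\ll_\rho b\ll_\rho c$ for some $b\in\mathbb{B}$; (BC2) if $a\,\rho\, b$ then there exists $c\in\mathbb{B}$ with $a\,\rho\,(c\wedge b)$;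 (BC3) if $a\neq0$ then there exists $b\in\mathbb{B}\setminus\{0\}$ with $b\ll_\rho a$. It is a CLCA if $A$ is complete. Two LCAs are isomorphic if there is a Boolean isomorphism that preserves and reflects the relation and maps the ideal onto the ideal. Define $a\,C_\rho\, b$ iff $a\,\rho\, b$ or $a,b\notin\mathbb{B}$. A cluster in $(A,\rho,\mathbb{B})$ is a non-empty $\sigma\subseteq A$ such that: $a,b\in\sigma$ implies $a\,C_\rho\, b$; $a\vee b\in\sigma$ implies $a\in\sigma$ or $b\in\sigma$; if $a\,C_\rho\, b$ for every $b\in\sigma$ then $a\in\sigma$. A cluster (or an ultrafilter of $A$) is bounded if it meets $\mathbb{B}$. $\Psi^a(A,\rho,\mathbb{B})$ is the set of all bounded clusters with the topology having as a base for the closed sets the family $\{\lambda_A^g(a) : a\in A\}$, where $\lambda_A^g(a)=\{\sigma : a\in\sigma\}$ ($\sigma$ ranging over bounded clusters). Each bounded ultrafilter $u$ in $A$ determines the bounded cluster $\sigma_u=\{a\in A : a\,C_\rho\, b\ \text{for all } b\in u\}$, and every bounded cluster is of this form. For a locally compact Hausdorff space $Z$, $\Psi^t(Z)=(RC(Z),\rho_Z,CR(Z))$, where $RC(Z)$ is the Boolean algebra of regular closed subsets of $Z$ (with $F\vee G=F\cup G$, $F\wedge G=\mathrm{cl}(\mathrm{int}(F\cap G))$, $F^*=\mathrm{cl}(Z\setminus F)$), $F\,\rho_Z\, G$ iff $F\cap G\neq\emptyset$, and $CR(Z)$ is the ideal of compact regular closed sets. The map $\Psi^a(\varphi):\Psi^a(B,\eta,\mathbb{B}')\to\Psi^a(A,\rho,\mathbb{B})$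 is given by $\Psi^a(\varphi)(\sigma_u)=\sigma_{\varphi^{-1}(u)}$ for every bounded ultrafilter $u$ in $(B,\eta,\mathbb{B}')$; it is a well-defined continuous map. For $a_0\in A$, $A|a_0$ is the Boolean algebra $\{b\in A : b\le a_0\}$ with the meets and joins of $A$ and complement $b'=b^*\wedge a_0$. The set $F$ carries the subspace topology from $X$. A map $f:G\to X$ is quasi-open if $\mathrm{int}(f(U))\neq\emptyset$ for every non-empty open $U\subseteq G$. *)

(* Defs.v *)
From HB Require Import structures.
From mathcomp Require Import all_boot all_order.
From mathcomp Require Import all_classical topology.

Set Implicit Arguments.
Unset Strict Implicit.
Unset Printing Implicit Defensive.

Import Order.Theory.
Local Open Scope classical_set_scope.

(* Boolean algebras are [ctbDistrLatticeType]s; the one-element algebra is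
   allowed. *)

Definition complete_lattice d (T : porderType d) : Prop :=
  forall S : set T, supremums S !=set0.

Definition is_ideal d (A : ctbDistrLatticeType d) (I : set A) : Prop :=
  [/\ I \bot%O,
      forall a b, (a <= b)%O -> I b -> I a &
      forall a b, I a -> I b -> I (a `|` b)%O].

Definition is_filter d (A : ctbDistrLatticeType d) (u : set A) : Prop :=
  [/\ u \top%O,
      forall a b, (a <= b)%O -> u a -> u b &
      forall a b, u a -> u b -> u (a `&` b)%O].

Definition is_ultrafilter d (A : ctbDistrLatticeType d) (u : set A) : Prop :=
  [/\ is_filter u, ~ u \bot%O &
      forall v : set A, is_filter v -> ~ v \bot%O -> u `<=` v -> v `<=` u].

(* The data (A, rho, BB) of a local contact algebra, without the axioms. *)
Record lca_triple d := LcaTriple {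
  carrier :> ctbDistrLatticeType d;
  contact : carrier -> carrier -> Prop;
  bounded : set carrier }.

Arguments bounded {d} A : rename.

Definition way_below d (A : lca_triple d) (a b : A) : Prop :=
  ~ contact a (~` b)%O.

Record is_lca d (A : lca_triple d) : Prop := IsLca {
  lca_ideal : is_ideal (bounded A);
  lca_C1 : forall a : A, a <> \bot%O -> contact a a;
  lca_C2 : forall a b : A, contact a b -> a <> \bot%O /\ b <> \bot%O;
  lca_C3 : forall a b : A, contact a b -> contact b a;
  lca_C4 : forall a b c : A,
    contact a (b `|` c)%O <-> contact a b \/ contact a c;
  lca_BC1 : forall a c : A, bounded A a -> way_below a c ->
    exists b : A, [/\ bounded A b, way_below a b & way_below b c];
  lca_BC2 : forall a b : A, contact a b ->
    exists c : A, bounded A c /\ contact a (c `&` b)%O;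
  lca_BC3 : forall a : A, a <> \bot%O ->
    exists b : A, [/\ bounded A b, b <> \bot%O & way_below b a] }.

Record lca d := Lca {
  lca_data :> lca_triple d;
  lcaP : is_lca lca_data }.

Definition lca_isomorphic d d' (A : lca_triple d) (B : lca_triple d') : Prop :=
  exists h : A -> B,
    [/\ bijective h,
        [/\ {morph h : a b / (a `&` b)%O}, {morph h : a b / (a `|` b)%O},
            {morph h : a / (~` a)%O}, h \bot%O = \bot%O & h \top%O = \top%O],
        forall a b, contact a b <-> contact (h a) (h b) &
        h @` bounded A = bounded B].

Section Clusters.
Context d (A : lca_triple d).

(* C_rho *)
Definition Crel (a b : A) : Prop :=
  contact a b \/ ~ bounded A a /\ ~ bounded A b.

Definition is_cluster (s : set A) : Prop :=
  [/\ s !=set0,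
      forall a b, s a -> s b -> Crel a b,
      forall a b, s (a `|` b)%O -> s a \/ s b &
      forall a, (forall b, s b -> Crel a b) -> s a].

Definition is_bounded (s : set A) : Prop := s `&` bounded A !=set0.

(* sigma_u *)
Definition sigma_set (u : set A) : set A :=
  [set a | forall b, u b -> Crel a b].

End Clusters.

Record bounded_ultrafilter d (A : lca_triple d) := BoundedUltrafilter {
  bultra_set :> set A;
  bultra_ultra : is_ultrafilter bultra_set;
  bultra_bounded : is_bounded bultra_set }.

(* The points of Psi^a(A). *)
Record bcluster d (A : lca d) := BCluster {
  bcluster_set :> set A;
  bcluster_cluster : is_cluster bcluster_set;
  bcluster_bounded : is_bounded bcluster_set }.

HB.instance Definition _ d (A : lca d) := gen_eqMixin (bcluster A).
HB.instance Definition _ d (A : lca d) := gen_choiceMixin (bcluster A).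

(* lambda_A^g *)
Definition lambda_g d (A : lca d) (a : A) : set (bcluster A) :=
  [set s | bcluster_set s a].

Section LcaTheory.
Context d (A : lca d).
Implicit Types a b c : A.

Lemma bounded_down a b : (a <= b)%O -> bounded A b -> bounded A a.
Proof. by case: (lca_ideal (lcaP A)) => _ + _; exact. Qed.

Lemma bounded_join a b :
  bounded A a -> bounded A b -> bounded A (a `|` b)%O.
Proof. by case: (lca_ideal (lcaP A)) => _ _; exact. Qed.

Lemma CrelC a b : Crel a b -> Crel b a.
Proof. by case=> [/(lca_C3 (lcaP A))|[]]; [left|right]. Qed.

Lemma CrelU a b c : Crel a (b `|` c)%O <-> Crel a b \/ Crel a c.
Proof.
split.
  case=> [/(lca_C4 (lcaP A))[]|[ha hbc]]; [by left; left|by right; left|].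
  have [hb|hb] := pselect (bounded A b); last by left; right.
  by right; right; split=> // hc; apply: hbc; exact: bounded_join.
case=> -[h|[ha hb]].
- by left; apply/(lca_C4 (lcaP A)); left.
- by right; split=> // /(bounded_down (leUl b c)).
- by left; apply/(lca_C4 (lcaP A)); right.
- by right; split=> // /(bounded_down (leUr c b)).
Qed.

Lemma Crel_le a b c : (b <= c)%O -> Crel a b -> Crel a c.
Proof. by move=> /join_idPl <- h; apply/CrelU; right. Qed.

Lemma Crel_neq0 a b : Crel a b -> b <> \bot%O.
Proof.
case=> [/(lca_C2 (lcaP A))[]//|[_ +]] b0; apply; rewrite b0.
by case: (lca_ideal (lcaP A)).
Qed.

Lemma Crel_meet a b : (a `&` b)%O <> \bot%O -> Crel a b.
Proof.
move=> /(lca_C1 (lcaP A)) h.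
apply: (@Crel_le _ (a `&` b)%O); first exact: leIr.
apply: CrelC; apply: (@Crel_le _ (a `&` b)%O); first exact: leIl.
by left.
Qed.

Lemma Crel_normal a c : ~ Crel a (~` c)%O ->
  exists b, ~ Crel a (~` b)%O /\ ~ Crel b (~` c)%O.
Proof.
move=> nac.
have wac : way_below a c by move=> h; apply: nac; left.
have [ba|nba] := pselect (bounded A a).
  have [b [bb ab bc]] := lca_BC1 (lcaP A) ba wac.
  by exists b; split=> -[//|[]].
have bc : bounded A (~` c)%O.
  by have [//|nbc] := pselect (bounded A (~` c)%O); exfalso; apply: nac; right.
have wca : way_below (~` c)%O (~` a)%O.
  by rewrite /way_below complK => /(lca_C3 (lcaP A)).
have [b [bb cb bA]] := lca_BC1 (lcaP A) bc wca.
exists (~` b)%O; rewrite complK; split.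
  by case=> [/(lca_C3 (lcaP A))|[]//]; move: bA; rewrite /way_below complK.
by move=> /CrelC [//|[]].
Qed.

Lemma cluster_le (s : bcluster A) a b :
  (a <= b)%O -> bcluster_set s a -> bcluster_set s b.
Proof.
case: s => s [_ sC _ sE] _ /= ab sa; apply: sE => c sc.
by apply: CrelC; apply: Crel_le ab _; exact: sC.
Qed.

Lemma cluster0 (s : bcluster A) : ~ bcluster_set s \bot%O.
Proof.
by case: s => s [_ sC _ _] _ /= s0; have /Crel_neq0 := sC _ _ s0 s0.
Qed.

Lemma ultra_compl (u : set A) a : is_ultrafilter u -> u a \/ u (~` a)%O.
Proof.
move=> [[u1 uS uI] u0 umax].
have [[b ub ab0]|nab] := pselect (exists2 b, u b & (a `&` b)%O = \bot%O).
  by right; apply: uS ub; rewrite -disj_leC meetC ab0.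
left; pose v := [set c | exists2 b, u b & (a `&` b <= c)%O].
apply: (umax v); last by exists \top%O => //; exact: leIl.
- split; first by exists \top%O.
  + by move=> b c bc [x ux xb]; exists x => //; exact: le_trans bc.
  + move=> b c [x ux xb] [y uy yc]; exists (x `&` y)%O; first exact: uI.
    by rewrite lexI (le_trans _ xb) ?(le_trans _ yc) ?leI2 ?leIl ?leIr.
- by move=> [b ub]; rewrite lex0 => /eqP ab0; apply: nab; exists b.
- by move=> b ub; exists b => //; exact: leIr.
Qed.

Lemma sub_sigma (u : set A) : is_ultrafilter u -> u `<=` sigma_set u.
Proof.
move=> [[_ _ uI] u0 _] a ua b ub; apply: Crel_meet => ab0.
by apply: u0; rewrite -ab0; exact: uI.
Qed.

Lemma sigma_cluster (u : bounded_ultrafilter A) : is_cluster (sigma_set u).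
Proof.
case: u => u uu [x [ux _]] /=; split.
- by exists x; exact: sub_sigma.
- move=> a b sa sb; apply: contrapT => nab.
  have [c [ac cb]] : exists c, ~ Crel a (~` c)%O /\ ~ Crel c (~` ~` b)%O.
    by apply: Crel_normal; rewrite complK.
  rewrite complK in cb.
  have [/sb/CrelC//|/sa//] := ultra_compl c uu.
- move=> a b sab; apply: contrapT => /not_orP[].
  move=> /existsNP[y /not_implyP[uy ay]] /existsNP[z /not_implyP[uz bz]].
  have [[_ _ uI] _ _] := uu.
  have /sab /CrelC /CrelU[] := uI _ _ uy uz.
    by move=> /CrelC /(Crel_le (leIl _ _)).
  by move=> /CrelC /(Crel_le (leIr _ _)).
- by move=> a ha b ub; apply: ha; exact: sub_sigma.
Qed.

Lemma sigma_bounded (u : bounded_ultrafilter A) : is_bounded (sigma_set u).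
Proof.
by case: u => u uu [x [ux bx]] /=; exists x; split=> //; exact: sub_sigma.
Qed.

Definition sigma (u : bounded_ultrafilter A) : bcluster A :=
  BCluster (sigma_cluster u) (sigma_bounded u).

Lemma lambda_g0 : lambda_g (\bot%O : A) = set0.
Proof. by apply/seteqP; split=> // s /cluster0. Qed.

Lemma lambda_gU a b : lambda_g (a `|` b)%O = lambda_g a `|` lambda_g b.
Proof.
apply/seteqP; split=> s; first by case: s => s [? ? sU ?] ? /=; exact: sU.
by case; apply: cluster_le; [exact: leUl|exact: leUr].
Qed.

(* Complements of the intersections of sets lambda_g a. *)
Definition Psi_a_open (U : set (bcluster A)) : Prop :=
  exists S : set A, U = ~` \bigcap_(a in S) lambda_g a.

Lemma Psi_a_openT : Psi_a_open setT.
Proof. by exists [set \bot%O]; rewrite bigcap_set1 lambda_g0 setC0. Qed.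

Lemma Psi_a_openI : setI_closed Psi_a_open.
Proof.
move=> _ _ [S ->] [T ->].
exists [set (p.1 `|` p.2)%O | p in S `*` T].
rewrite -setCU; congr (~` _); apply/seteqP; split=> s.
  move=> st _ [[a b] [/= Sa Tb] <-]; rewrite lambda_gU.
  by case: st => h; [left|right]; exact: h.
move=> h; apply: contrapT => /not_orP[].
move=> /existsNP[a /not_implyP[Sa na]] /existsNP[b /not_implyP[Tb nb]].
have : lambda_g (a `|` b)%O s by apply: h; exists (a, b).
by rewrite lambda_gU => -[].
Qed.

Lemma Psi_a_open_bigU (I : Type) (f : I -> set (bcluster A)) :
  (forall i, Psi_a_open (f i)) -> Psi_a_open (\bigcup_i f i).
Proof.
move=> /choice[S fS]; exists (\bigcup_i S i).
apply/seteqP; split=> s.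
  by move=> [i _]; rewrite fS => + h; apply=> a Sa; apply: h; exists i.
move=> /existsNP[a /not_implyP[[i _ Sa] nsa]]; exists i => //.
by rewrite fS => /(_ _ Sa).
Qed.

HB.instance Definition _ := isOpenTopological.Build (bcluster A)
  Psi_a_openT Psi_a_openI Psi_a_open_bigU.

(* The sets lambda_g a are a base for the closed sets. *)
Lemma Psi_a_closedP (C : set (bcluster A)) :
  closed C <-> exists S : set A, C = \bigcap_(a in S) lambda_g a.
Proof.
rewrite -openC; split=> [[S CS]|[S ->]]; last by exists S.
by exists S; apply: setC_inj.
Qed.

End LcaTheory.

Definition Psi_a d (A : lca d) : topologicalType := bcluster A.

(* f = Psi^a(phi) *)
Definition is_Psi_a_map d d' (A : lca d) (B : lca d') (phi : A -> B)
    (f : Psi_a B -> Psi_a A) : Prop :=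
  forall u : bounded_ultrafilter B,
    bcluster_set (f (sigma u)) = sigma_set (phi @^-1` u).

(* A|a0 *)
Record below d (A : ctbDistrLatticeType d) (a0 : A) := Below {
  below_val :> A;
  belowP : (below_val <= a0)%O }.

Section Below.
Context d (A : ctbDistrLatticeType d) (a0 : A).
Local Notation B := (below a0).

HB.instance Definition _ := [isSub for @below_val d A a0].
HB.instance Definition _ := [Choice of B by <:].

Fact below_meet_closed : meet_closed (fun b : A => (b <= a0)%O).
Proof. by move=> x y xa ya; exact: leIxl. Qed.

Fact below_join_closed : join_closed (fun b : A => (b <= a0)%O).
Proof. by move=> x y xa ya; rewrite -topredE /= leUx; apply/andP. Qed.

HB.instance Definition _ := @Order.SubChoice_isSubLattice.Build
  d A (fun b : A => (b <= a0)%O) d B below_meet_closed below_join_closed.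

Lemma below_valI (x y : B) :
  below_val (x `&` y)%O = (below_val x `&` below_val y)%O.
Proof. by []. Qed.

Lemma below_valU (x y : B) :
  below_val (x `|` y)%O = (below_val x `|` below_val y)%O.
Proof. by []. Qed.

Lemma below_leE (x y : B) : (x <= y)%O = (below_val x <= below_val y)%O.
Proof. by []. Qed.

Fact below_meetUl : @left_distributive B B Order.meet Order.join.
Proof.
by move=> x y z; apply: val_inj; exact: meetUl.
Qed.

HB.instance Definition _ :=
  Order.Lattice_Meet_isDistrLattice.Build d B below_meetUl.

Fact below_le0x (b : B) : (Below (le0x a0) <= b)%O.
Proof. by rewrite below_leE /= le0x. Qed.

Fact below_lex1 (b : B) : (b <= Below (lexx a0))%O.
Proof. by rewrite below_leE /= belowP. Qed.

HB.instance Definition _ := Order.hasBottom.Build d B below_le0x.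
HB.instance Definition _ := Order.hasTop.Build d B below_lex1.

Definition restr (a : A) : B := Below (leIr a0 a).

Definition below_compl (b : B) : B := restr (~` (b : A))%O.

Fact below_joinxC (b : B) : (b `|` below_compl b)%O = \top%O.
Proof.
apply: val_inj; rewrite /=.
by rewrite joinIr joinxC meet1x; apply/join_idPr/belowP.
Qed.

Fact below_meetxC (b : B) : (b `&` below_compl b)%O = \bot%O.
Proof. by apply: val_inj; rewrite /= meetA meetxC meet0x. Qed.

HB.instance Definition _ := Order.TBDistrLattice_hasComplement.Build d B
  below_joinxC below_meetxC.

End Below.

(* RC(Z) *)
Record regular_closed (Z : topologicalType) := RegularClosed {
  rc_set :> set Z;
  rcP : regclosed rc_set }.

Fact rc_display : Order.disp_t. Proof. exact: Order.Disp tt tt. Qed.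

Section RegularClosed.
Variable Z : topologicalType.
Local Notation RC := (regular_closed Z).
Implicit Types F G H : RC.

HB.instance Definition _ := gen_eqMixin RC.
HB.instance Definition _ := gen_choiceMixin RC.

Lemma rc_inj F G : F = G :> set Z -> F = G.
Proof.
case: F G => F Fr [G Gr] /= FG; subst; congr RegularClosed.
exact: Prop_irrelevance.
Qed.

Lemma rc_closed F : closed F.
Proof. by rewrite -(rcP F); exact: closed_closure. Qed.

Definition rc_le F G : bool := `[< F `<=` G >].

Fact rc_le_refl : reflexive rc_le.
Proof. by move=> F; apply/asboolP. Qed.

Fact rc_le_anti : antisymmetric rc_le.
Proof.
by move=> F G /andP[/asboolP FG /asboolP GF]; apply: rc_inj; apply/seteqP.
Qed.

Fact rc_le_trans : transitive rc_le.
Proof.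
move=> G F H /asboolP FG /asboolP GH; apply/asboolP; exact: subset_trans GH.
Qed.

HB.instance Definition _ := Order.Le_isPOrder.Build rc_display RC
  rc_le_refl rc_le_anti rc_le_trans.

Fact rc_meet_subproof F G : regclosed (closure ((F `&` G)°)).
Proof. exact: closure_interior_idem. Qed.

Definition rc_meet F G : RC := RegularClosed (rc_meet_subproof F G).

Fact rc_join_subproof F G : regclosed (F `|` G).
Proof.
apply/seteqP; split.
  have cFG : closed (F `|` G) by apply: closedU; exact: rc_closed.
  rewrite [X in _ `<=` X](closure_id _).1//.
  by apply: closureS; exact: interior_subset.
rewrite -{1}(rcP F) -{1}(rcP G) -closureU.
by apply: closureS; exact: interiorU.
Qed.

Definition rc_join F G : RC := RegularClosed (rc_join_subproof F G).

Fact rc_compl_subproof F : regclosed (closure (~` F)).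
Proof.
by apply: closure_open_regclosed; apply: closed_openC; exact: rc_closed.
Qed.

Definition rc_compl F : RC := RegularClosed (rc_compl_subproof F).

Lemma rc_leP F G : reflect (F `<=` G) (F <= G)%O.
Proof. exact: asboolP. Qed.

Lemma rc_meet_sub F G : rc_meet F G `<=` F `&` G.
Proof.
have cFG : closed (F `&` G) by apply: closedI; exact: rc_closed.
rewrite [X in _ `<=` X](closure_id _).1//=.
by apply: closureS; exact: interior_subset.
Qed.

Fact rc_meetP F G H : (F <= rc_meet G H)%O = (F <= G)%O && (F <= H)%O.
Proof.
apply/rc_leP/andP => [h|[/rc_leP FG /rc_leP FH]].
  by split; apply/rc_leP => x /h /rc_meet_sub[].
rewrite /= -(rcP F); apply/closureS/interiorS => x Fx; split;
  by [exact: FG|exact: FH].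
Qed.

Fact rc_joinP F G H : (rc_join F G <= H)%O = (F <= H)%O && (G <= H)%O.
Proof.
apply/rc_leP/andP => [h|[/rc_leP FH /rc_leP GH] x [/FH|/GH]//].
by split; apply/rc_leP => x ?; apply: h; [left|right].
Qed.

HB.instance Definition _ := Order.POrder_MeetJoin_isLattice.Build rc_display RC
  rc_meetP rc_joinP.

(* An open set disjoint from F ∧ G and contained in F misses G. *)
Lemma rc_meet_disj F G (V : set Z) : open V -> V `<=` F ->
  V `&` rc_meet F G = set0 -> V `&` G = set0.
Proof.
move=> oV VF VFG; rewrite -subset0 => x [Vx]; rewrite -(rcP G) => Gx.
have [y [Gy Vy]] := Gx V (open_nbhs_nbhs (conj oV Vx)).
have : (V `&` rc_meet F G) y.
  split=> //=; apply: subset_closure; rewrite interiorI; split=> //.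
  by apply: (interiorS VF); move/interior_id: oV => ->.
by rewrite VFG.
Qed.

Fact rc_meetUl : @left_distributive RC RC Order.meet Order.join.
Proof.
move=> G H F; apply/eqP; rewrite eq_le; apply/andP; split; last first.
  by rewrite leUx !leI2 ?leUl ?leUr.
rewrite ![(_ `&` F)%O]meetC; apply/rc_leP.
pose K := ((F `&` G) `|` (F `&` H))%O; rewrite -/K.
rewrite [X in _ `<=` X](closure_id _).1; last exact: rc_closed.
apply: closureS => x FGx; apply: contrapT => nKx.
pose V := (F `&` (G `|` H)%O)° `\` K.
have oV : open V.
  by apply: openI; [exact: open_interior|apply: closed_openC; exact: rc_closed].
have VFGH : V `<=` F `&` (G `|` H) by move=> y [/interior_subset].
have VF : V `<=` F by move=> y /VFGH[].
have VG : V `&` G = set0.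
  apply: (@rc_meet_disj F) => //; rewrite -subset0 => y [[_ nKy] h].
  by apply: nKy; exact: or_introl.
have VH : V `&` H = set0.
  apply: (@rc_meet_disj F) => //; rewrite -subset0 => y [[_ nKy] h].
  by apply: nKy; exact: or_intror.
have Vx : V x by [].
have [_ [Gx|Hx]] := VFGH _ Vx.
  by have : (V `&` G) x by []; rewrite VG.
by have : (V `&` H) x by []; rewrite VH.
Qed.

HB.instance Definition _ :=
  Order.Lattice_Meet_isDistrLattice.Build rc_display RC rc_meetUl.

Fact rc0_subproof : regclosed (@set0 Z).
Proof. by rewrite /regclosed interior0 closure0. Qed.

Fact rcT_subproof : regclosed (@setT Z).
Proof. by rewrite /regclosed interiorT closureT. Qed.

Fact rc_le0x F : (RegularClosed rc0_subproof <= F)%O.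
Proof. by apply/rc_leP => x. Qed.

Fact rc_lex1 F : (F <= RegularClosed rcT_subproof)%O.
Proof. by apply/rc_leP => x. Qed.

HB.instance Definition _ := Order.hasBottom.Build rc_display RC rc_le0x.
HB.instance Definition _ := Order.hasTop.Build rc_display RC rc_lex1.

Fact rc_joinxC F : (F `|` rc_compl F)%O = \top%O.
Proof.
apply: rc_inj; apply/seteqP; split=> // x _.
have [Fx|nFx] := pselect ((F : set Z) x); [by left|right].
exact: subset_closure.
Qed.

Fact rc_meetxC F : (F `&` rc_compl F)%O = \bot%O.
Proof.
apply: rc_inj => /=; rewrite interiorI closure_setC.
rewrite -[RHS]closure0; congr closure; rewrite -subset0 => x [Fx].
by move=> /interior_subset.
Qed.

HB.instance Definition _ := Order.TBDistrLattice_hasComplement.Build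
  rc_display RC rc_joinxC rc_meetxC.

End RegularClosed.

(* The triple makes sense for every space Z; it satisfies the axioms of a
   local contact algebra when Z is locally compact Hausdorff. *)
Definition Psi_t (Z : topologicalType) : lca_triple rc_display :=
  @LcaTriple rc_display (regular_closed Z)
    (fun F G => F `&` G !=set0) [set F | compact F].

Definition homeomorphic (S T : topologicalType) : Prop :=
  exists (f : S -> T) (g : T -> S),
    [/\ continuous f, continuous g, cancel f g & cancel g f].

Definition closed_map (S T : topologicalType) (f : S -> T) : Prop :=
  forall C : set S, closed C -> closed (f @` C).

Definition quasi_open (S T : topologicalType) (f : S -> T) : Prop :=
  forall U : set S, open U -> U !=set0 -> (f @` U)° !=set0.

(* Main.v *)
Require Import Defs.
From mathcomp Require Import all_boot all_order.
From mathcomp Require Import all_classical topology.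

Local Open Scope classical_set_scope.
Import Order.Theory.

Set Implicit Arguments.
Unset Strict Implicit.
Unset Printing Implicit Defensive.

(** A cluster is determined by any ultrafilter it contains, and it contains one
    through each of its elements: this is an instance of the fact that a grill
    (an up-closed, join-prime set without [\bot]) is a union of ultrafilters
    ([grill_ultrafilter]). All existence statements about points come from it,
    applied to a cluster or to the grill of the elements related to a given one.

    The relation of [B = A|a0] and its bounded elements are those of [A], so
    [Crel] on [B] is the restriction of [Crel] on [A]. Hence the image under
    [f = Psi^a(phi)] of a bounded cluster [t] of [B] is the set of all [a] in [A]
    that are related to every element of [t] ([restr_dualE]). This description
    no longer mentions ultrafilters, so [f] is well defined; and [f t] meets [B]
    exactly in [t] ([restr_dual_below]), so [f] is injective and maps
    [lambda_g b] onto [lambda_g b] for [b <= a0]. With [b] the top of [B] this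
    says that the range is [F] ([range_restr_dual]), and by intersection [f] is
    closed. Continuity is the normality of [Crel], and quasi-openness holds
    because an element of [B] other than [a0] does not reach [\top] when joined
    with the complement of [a0].
    A continuous closed injection is a homeomorphism onto its range.

    The isomorphism of [Psi_t F] with [B] is the representation theorem for the
    complete local contact algebra [B] ([Psi_t_Psi_a]) moved along the
    homeomorphism. The map [a |-> lambda_g a] is a bijection onto the regular
    closed sets because the closure of the union of basic open sets
    [~` lambda_g x] is [lambda_g] of the supremum of the [~` x]
    ([closure_open_lambda]). It turns contact into intersection
    ([contact_cluster]), and [a] is bounded exactly when [lambda_g a] is compact
    ([compact_lambda_g], [lambda_g_bounded]). *)

(** * Grills and ultrafilters *)

Section Grills.
Context d (A : ctbDistrLatticeType d).
Implicit Types (a b c : A) (s u : set A).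

Definition is_grill s : Prop :=
  [/\ ~ s \bot%O,
      forall a b, (a <= b)%O -> s a -> s b &
      forall a b, s (a `|` b)%O -> s a \/ s b].

Lemma le_joinC a b : ((~` a `|` b)%O = \top%O) <-> (a <= b)%O.
Proof.
split=> [h|ab]; last first.
  apply/eqP; rewrite -le1x -(joinCx b); apply: leU2 => //.
  by rewrite leC.
rewrite -(meetx1 a) -h meetUr meetxC join0x; exact: leIr.
Qed.

Lemma filter_ultra u : is_filter u -> ~ u \bot%O ->
  (forall a, u a \/ u (~` a)%O) -> is_ultrafilter u.
Proof.
move=> uf u0 ud; split=> // v [_ _ vI] v0 uv a va.
have [//|/uv vca] := ud a.
by exfalso; apply: v0; rewrite -(meetxC a); exact: vI.
Qed.

(** A filter that is maximal among those contained in the grill decides every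
    element [b]: if neither [b] nor its complement could be added, the grill
    would omit the two parts of some element of the filter. *)
Lemma grill_ultrafilter s a : is_grill s -> s a ->
  exists u, [/\ is_ultrafilter u, u a & u `<=` s].
Proof.
move=> [s0 sS sU] sa.
pose P (v : set A) := v = set0 \/ [/\ is_filter v, v a & v `<=` s].
(* The empty set is admitted so that the empty chain has an upper bound. *)
have chainP (C : set (set A)) : C `<=` P -> total_on C subset ->
    P (\bigcup_(X in C) X).
  move=> CP Ctot.
  have [[v [Cv [x vx]]]|Ce] := pselect (exists v, C v /\ v !=set0); last first.
    left; rewrite -subset0 => x [v Cv vx]; apply: Ce.
    by exists v; split=> //; exists x.
  right.
  have good w y : C w -> w y -> [/\ is_filter w, w a & w `<=` s].
    by move=> /CP[->|//].
  have [[v1 _ _] va _] := good _ _ Cv vx.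
  split; [split| |].
  - by exists v.
  - move=> b c bc [w Cw wb]; exists w => //.
    by have [[_ wS _] _ _] := good _ _ Cw wb; exact: wS wb.
  - move=> b c [w Cw wb] [w' Cw' wc].
    have [[_ _ wI] _ _] := good _ _ Cw wb.
    have [[_ _ wI'] _ _] := good _ _ Cw' wc.
    have [ww'|w'w] := Ctot _ _ Cw Cw'.
      by exists w' => //; apply: wI' => //; exact: ww'.
    by exists w => //; apply: wI => //; exact: w'w.
  - by exists v.
  - by move=> b [w Cw wb]; have [_ _] := good _ _ Cw wb; exact.
have [u [Pu umax]] := Zorn_bigcup chainP.
pose adjoin (w : set A) b := [set c | exists2 m, w m & (m `&` b <= c)%O].
have adjoinP (w : set A) b : is_filter w -> w a ->
    (forall m, w m -> s (m `&` b)%O) -> P (adjoin w b).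
  move=> [w1 wS wI] wa wb; right; split; [split| |].
  - by exists \top%O => //; exact: lex1.
  - by move=> x y xy [m wm mx]; exists m => //; exact: le_trans xy.
  - move=> x y [m wm mx] [n wn ny]; exists (m `&` n)%O; first exact: wI.
    by rewrite lexI (le_trans _ mx) ?(le_trans _ ny) ?leI2 ?leIl ?leIr.
  - by exists a => //; exact: leIl.
  - by move=> x [m wm mx]; apply: sS mx _; exact: wb.
case: Pu => [u0|[uf ua us]].
  exfalso; apply: (umax [set c | (a <= c)%O]).
    rewrite u0; split; first by [].
    by move=> /(_ a); apply; exact: lexx.
  right; split; [split| |].
  - exact: lex1.
  - by move=> b c bc /= /le_trans; apply.
  - by move=> b c /= ab ac; rewrite lexI ab.
  - exact: lexx.
  - by move=> b /= ab; exact: sS sa.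
exists u; split=> //; apply: filter_ultra => // [/us//|b].
have [_ uS uI] := uf.
have adjoin_mem c : (forall m, u m -> s (m `&` c)%O) -> u c.
  move=> hc; apply: contrapT => nuc.
  apply: (umax (adjoin u c)); last exact: adjoinP.
  split; first by move=> m um; exists m => //; exact: leIl.
  by move=> /(_ c) h; apply/nuc/h; exists a => //; exact: leIr.
apply: contrapT => /not_orP[nb ncb].
have [m [um nm]] : exists m, u m /\ ~ s (m `&` b)%O.
  apply: contrapT => h; apply: nb; apply: adjoin_mem => m um.
  by apply: contrapT => ns; apply: h; exists m.
have [n [un nn]] : exists n, u n /\ ~ s (n `&` ~` b)%O.
  apply: contrapT => h; apply: ncb; apply: adjoin_mem => n un.
  by apply: contrapT => ns; apply: h; exists n.
have : s ((m `&` b) `|` (n `&` ~` b))%O.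
  apply: (sS (m `&` n)%O); last by apply: us; exact: uI.
  rewrite -[X in (X <= _)%O]meetx1 -(joinxC b) meetUr.
  by apply: leU2; apply: leI2; rewrite ?leIl ?leIr.
by case/sU.
Qed.

End Grills.

(** * Bounded clusters and bounded ultrafilters *)

Section Clusters.
Context d (A : lca d).
Implicit Types (a b c x : A) (s t : bcluster A).

Lemma contact_le a b c : (b <= c)%O -> contact a b -> contact a c.
Proof. by move=> /join_idPl <- h; apply/(lca_C4 (lcaP A)); right. Qed.

Lemma Crel_bounded a b : bounded A b -> Crel a b -> contact a b.
Proof. by move=> bb [//|[]]. Qed.

Lemma Crel_grill a : is_grill (@Crel _ A a).
Proof.
split; first by move=> /Crel_neq0.
- by move=> b c; exact: Crel_le.
- by move=> b c /CrelU.
Qed.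

Lemma bcluster_eq s t : bcluster_set s = bcluster_set t -> s = t.
Proof.
case: s t => s sc sb [t tc tb] /= st; subst t.
by congr BCluster; exact: Prop_irrelevance.
Qed.

Lemma cluster_Crel s a b : bcluster_set s a -> bcluster_set s b -> Crel a b.
Proof. by case: (bcluster_cluster s) => _ sC _ _; exact: sC. Qed.

Lemma cluster_max s a : (forall b, bcluster_set s b -> Crel a b) ->
  bcluster_set s a.
Proof. by case: (bcluster_cluster s) => _ _ _ sE; exact: sE. Qed.

Lemma cluster_join s a b : bcluster_set s (a `|` b)%O ->
  bcluster_set s a \/ bcluster_set s b.
Proof. by case: (bcluster_cluster s) => _ _ sU _; exact: sU. Qed.

Lemma cluster_top s : bcluster_set s \top%O.
Proof.
have [[x sx] _ _ _] := bcluster_cluster s.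
exact: cluster_le (lex1 x) sx.
Qed.

Lemma cluster_grill s : is_grill (bcluster_set s).
Proof.
split; [exact: cluster0|by move=> a b; exact: cluster_le|].
exact: cluster_join.
Qed.

(** Local compactness of the dual space in algebraic form: if [x] is a bounded
    element of the cluster, then interpolation in [x << \top] gives a bounded
    [y] whose complement is not in contact with [x], hence is outside the cluster. *)
Lemma cluster_local s :
  exists y, bounded A y /\ ~ bcluster_set s (~` y)%O.
Proof.
have [x [sx bx]] := bcluster_bounded s.
have x1 : way_below x \top%O.
  by rewrite /way_below compl1 => /(lca_C2 (lcaP A))[].
have [y [yb xy _]] := lca_BC1 (lcaP A) bx x1.
exists y; split=> // sy; apply: xy.
by apply: (lca_C3 (lcaP A)); apply: Crel_bounded bx _; exact: (cluster_Crel sy sx).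
Qed.

Lemma cluster_bounded_below s a : bcluster_set s a ->
  exists b, [/\ (b <= a)%O, bounded A b & bcluster_set s b].
Proof.
move=> sa; have [y [by_ nsy]] := cluster_local s.
exists (a `&` y)%O; split; first exact: leIl.
  exact: bounded_down (leIr _ _) by_.
have : bcluster_set s ((a `&` y) `|` (a `&` ~` y))%O.
  by rewrite -meetUr joinxC meetx1.
by case/cluster_join => // /(cluster_le (leIr _ _)).
Qed.

(** Clusters are maximal sets of pairwise [Crel]-related elements, so it
    suffices to compare one inclusion. *)
Lemma sigma_sub_cluster (u : bounded_ultrafilter A) s :
  u `<=` bcluster_set s -> sigma u = s.
Proof.
move=> us.
have ssu : bcluster_set s `<=` sigma_set u.
  by move=> a sa b ub; apply: cluster_Crel sa (us _ ub).
apply: bcluster_eq; apply/seteqP; split=> // a ha.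
apply: cluster_max => b sb.
apply: (@cluster_Crel (sigma u)) => //; exact: ssu.
Qed.

Lemma cluster_ultra s a : bcluster_set s a ->
  exists u : bounded_ultrafilter A,
    [/\ bultra_set u a, u `<=` bcluster_set s & sigma u = s].
Proof.
move=> sa; have [b [ba bb sb]] := cluster_bounded_below sa.
have [u [uu ub us]] := grill_ultrafilter (cluster_grill s) sb.
have ubd : is_bounded u by exists b.
exists (BoundedUltrafilter uu ubd); split=> //=.
  by have [[_ uS _] _ _] := uu; exact: uS ub.
exact: sigma_sub_cluster.
Qed.

Lemma cluster_sigma s : exists u : bounded_ultrafilter A, s = sigma u.
Proof. by have [u [_ _ <-]] := cluster_ultra (cluster_top s); exists u. Qed.

(** A contact [a rho b] is witnessed inside a bounded part of [b], and any
    ultrafilter through that part made of elements related to [a] gives the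
    common point. Conversely, passing to a bounded part of [b] in the cluster
    turns [Crel] back into contact. *)
Lemma contact_cluster a b : contact a b <->
  exists s, bcluster_set s a /\ bcluster_set s b.
Proof.
split=> [ab|[s [sa sb]]]; last first.
  have [c [ca bc sc]] := cluster_bounded_below sb.
  by apply: contact_le ca _; apply: Crel_bounded bc _; exact: cluster_Crel sc.
have [c [bc abc]] := lca_BC2 (lcaP A) ab.
have [u [uu ucb ua]] := grill_ultrafilter (Crel_grill a) (or_introl abc).
have [[_ uS _] _ _] := uu.
have ubd : is_bounded u.
  by exists c; split=> //; exact: uS (leIl _ _) ucb.
exists (sigma (BoundedUltrafilter uu ubd)); split=> //=.
by apply: (sub_sigma uu); exact: uS (leIr _ _) ucb.
Qed.

(** A bounded nonzero [b << ~` a] lies in some cluster, and no cluster through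
    [b] contains [a]. *)
Lemma bcluster_avoid a : a <> \top%O -> exists s, ~ bcluster_set s a.
Proof.
move=> na; have : (~` a)%O <> \bot%O.
  by move=> h; apply: na; rewrite -(complK a) h compl0.
move=> /(lca_BC3 (lcaP A))[b [bb b0]]; rewrite /way_below complK => nba.
have /contact_cluster[s [sb _]] := lca_C1 (lcaP A) b0.
exists s => sa; apply: nba; apply: (lca_C3 (lcaP A)).
by apply: Crel_bounded bb _; exact: cluster_Crel sa sb.
Qed.

Lemma lambda_g_le a b : ((lambda_g a : set (bcluster A)) `<=` lambda_g b) <->
  (a <= b)%O.
Proof.
split=> [ab|ab s]; last exact: cluster_le.
apply/le_joinC; apply: contrapT => /bcluster_avoid[s ns]; apply: ns.
have : bcluster_set s (~` a `|` a)%O by rewrite joinCx; exact: cluster_top.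
case/cluster_join => [|/ab]; apply: cluster_le; [exact: leUl|exact: leUr].
Qed.

Lemma lambda_gC_sub a : ~` (lambda_g (~` a)%O : set (bcluster A)) `<=` lambda_g a.
Proof.
move=> s ns; have : bcluster_set s (a `|` ~` a)%O.
  by rewrite joinxC; exact: cluster_top.
by case/cluster_join.
Qed.

(** As only [\top] belongs to all bounded clusters, [lambda_g] reflects
    coverings of the space by two basic closed sets. *)
Lemma lambda_gC_subP a b :
  (~` (lambda_g a : set (bcluster A)) `<=` lambda_g b) <-> (~` a <= b)%O.
Proof.
rewrite -le_joinC complK; split=> [ab|ab s nsa].
  apply: contrapT => /bcluster_avoid[s ns]; apply: ns.
  have [sa|/ab sb] := pselect (lambda_g a s).
    exact: cluster_le (leUl _ _) sa.
  exact: cluster_le (leUr _ _) sb.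
have : bcluster_set s (a `|` b)%O by rewrite ab; exact: cluster_top.
by case/cluster_join.
Qed.

Lemma lambda_g_closed a : closed (lambda_g a : set (Psi_a A)).
Proof. by apply/Psi_a_closedP; exists [set a]; rewrite bigcap_set1. Qed.

Lemma lambda_g_nbhs s a : ~ bcluster_set s a ->
  nbhs (s : Psi_a A) (~` lambda_g a).
Proof.
move=> nsa; apply: open_nbhs_nbhs; split=> //.
by apply: closed_openC; exact: lambda_g_closed.
Qed.

(** * The representation of a complete algebra by regular closed sets *)

(** The closure is the intersection of the basic closed sets containing the
    open set, and [lambda_g c] contains it exactly when [c] is an upper bound of
    the complements. *)
Lemma closure_open_lambda (S : set A) (m : A) :
  supremums [set (~` x)%O | x in S] m ->
  closure (~` \bigcap_(x in S) lambda_g x : set (Psi_a A)) = lambda_g m.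
Proof.
move=> [mub mlub].
set U := ~` _.
have UP c : U `<=` lambda_g c <-> ubound [set (~` x)%O | x in S] c.
  split=> [Uc _ [x Sx <-]|cub s /existsNP[x /not_implyP[Sx nsx]]].
    apply/lambda_gC_subP; apply: subset_trans Uc => s nsx h.
    by apply: nsx; exact: h.
  have /lambda_gC_subP : (~` x <= c)%O by apply: cub; exists x.
  exact.
apply/seteqP; split.
  rewrite [X in _ `<=` X](closure_id _).1; last exact: lambda_g_closed.
  by apply: closureS; apply/UP.
have /Psi_a_closedP[T Tcl] := @closed_closure (Psi_a A) U.
rewrite Tcl => s sm c Tc; apply: cluster_le sm.
apply: mlub; apply/UP; apply: subset_trans (@subset_closure _ U) _.
by rewrite Tcl => t; exact.
Qed.

Lemma closure_lambda_gC a :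
  closure (~` lambda_g a : set (Psi_a A)) = lambda_g (~` a)%O.
Proof.
rewrite -[X in ~` X](bigcap_set1 (@lambda_g _ A)).
by apply: closure_open_lambda; rewrite image_set1 supremums1.
Qed.

Lemma interior_lambda_g a :
  (lambda_g a : set (Psi_a A))° = ~` lambda_g (~` a)%O.
Proof. by rewrite -closure_lambda_gC closure_setC setCK. Qed.

Lemma regclosed_lambda_g a : regclosed (lambda_g a : set (Psi_a A)).
Proof. by rewrite /regclosed interior_lambda_g closure_lambda_gC complK. Qed.

(** An ultrafilter of subsets containing [lambda_g b] picks out the grill of
    those [a] with [lambda_g a] in it; a bounded ultrafilter of [A] inside that
    grill determines a limit. *)
Lemma compact_lambda_g b : bounded A b -> compact (lambda_g b : set (Psi_a A)).
Proof.
move=> bb; rewrite compact_ultra /= => F FU Fb.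
have FP := @ultra_proper _ F FU.
have grF : is_grill [set a | F (lambda_g a)].
  split=> [|a c ac Fa|a c] /=.
  - by rewrite lambda_g0 => /filter_ex[].
  - by apply: filterS Fa; apply/lambda_g_le.
  - rewrite lambda_gU => Fac; have [|nFa] := in_ultra_setVsetC (lambda_g a) FU.
      by left.
    by right; apply: filterS (filterI nFa Fac) => s [nsa []].
have [u [uu ub uF]] := grill_ultrafilter grF Fb.
have ubd : is_bounded u by exists b.
exists (sigma (BoundedUltrafilter uu ubd)); split; first exact: sub_sigma.
move=> N; rewrite nbhsE => -[V [oV Vs] VN]; apply: filterS VN _.
move: oV Vs => [S ->] /existsNP[c /not_implyP[Sc nc]].
have [x [ux ncx]] : exists x, u x /\ ~ Crel c x.
  by move: nc => /existsNP[x /not_implyP[ux ncx]]; exists x.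
apply: filterS (uF _ ux) => s sx h.
by apply: ncx; apply: cluster_Crel (h _ Sc) sx.
Qed.

(** The sets [lambda_g b \ lambda_g y] with [y] bounded form a filter base
    without a cluster point, since every point has a neighbourhood
    contained in some [lambda_g y]. *)
Lemma lambda_g_bounded b : compact (lambda_g b : set (Psi_a A)) -> bounded A b.
Proof.
move=> cb; apply: contrapT => nb.
have bd0 : bounded A \bot%O by case: (lca_ideal (lcaP A)).
pose B (y : A) : set (Psi_a A) := lambda_g b `\` lambda_g y.
have FP : ProperFilter (filter_from (bounded A) B).
  apply: filter_from_proper.
    apply: filter_from_filter; first by exists \bot%O.
    move=> y z by_ bz; exists (y `|` z)%O; first exact: bounded_join.
    by move=> s [sb]; rewrite lambda_gU => /not_orP[ny nz].
  move=> y by_; apply: contrapT => h; apply: nb; apply: bounded_down by_.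
  apply/lambda_g_le => s sb; apply: contrapT => nsy; apply: h.
  by exists s.
have [|s [sb scl]] := cb _ FP; first by exists \bot%O => // s [].
have [y [by_ nsy]] := cluster_local s.
have [|t [[_ nty] nty']] := scl (B y) _ _ (lambda_g_nbhs nsy).
  by exists y.
by apply: nty; exact: lambda_gC_sub.
Qed.

Definition lambda_rc a : Psi_t (Psi_a A) := RegularClosed (regclosed_lambda_g a).

Lemma lambda_rc_inj : injective lambda_rc.
Proof.
move=> a b /(congr1 (@rc_set _)) /= ab.
by apply/eqP; rewrite eq_le; apply/andP; split; apply/lambda_g_le; rewrite ab.
Qed.

Lemma lambda_rc_surj : complete_lattice A ->
  forall C : Psi_t (Psi_a A), exists a, lambda_rc a = C.
Proof.
move=> cA C; have [S Sint] : open ((C : set (Psi_a A))°).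
  exact: open_interior.
have [m msup] := cA [set (~` x)%O | x in S].
exists m; apply: rc_inj => /=.
by rewrite -(closure_open_lambda msup) -Sint; exact: rcP.
Qed.

End Clusters.

(** * Isomorphisms of contact algebras *)

Lemma lca_isomorphic_sym d d' (A : lca_triple d) (B : lca_triple d') :
  lca_isomorphic A B -> lca_isomorphic B A.
Proof.
move=> [h [[g hK gK] [hI hU hC h0 h1] hrho hbd]]; exists g; split.
- by exists h.
- split=> [a b|a b|a||]; apply: (can_inj hK).
  + by rewrite hI !gK.
  + by rewrite hU !gK.
  + by rewrite hC !gK.
  + by rewrite h0 gK.
  + by rewrite h1 gK.
- by move=> a b; rewrite hrho !gK.
- rewrite -hbd; apply/seteqP; split=> [_ [_ [a ba <-] <-]|a ba]; rewrite ?hK//.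
  by exists (h a); [exists a|rewrite hK].
Qed.

Lemma lca_isomorphic_trans d d' d'' (A : lca_triple d) (B : lca_triple d')
    (C : lca_triple d'') :
  lca_isomorphic A B -> lca_isomorphic B C -> lca_isomorphic A C.
Proof.
move=> [h [hbij [hI hU hC h0 h1] hrho hbd]] [k [kbij [kI kU kC k0 k1] krho kbd]].
exists (k \o h); split.
- exact: bij_comp.
- split=> [a b|a b|a||] /=.
  + by rewrite hI kI.
  + by rewrite hU kU.
  + by rewrite hC kC.
  + by rewrite h0.
  + by rewrite h1.
- by move=> a b; rewrite hrho krho.
- by rewrite -image_comp hbd kbd.
Qed.

(** The meet is determined by join and complement, and the bounds by
    surjectivity, hence a bijection preserving join and complement suffices. *)
Lemma lca_isomorphicI d d' (A : lca_triple d) (B : lca_triple d') (h : A -> B) :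
  bijective h -> {morph h : a b / (a `|` b)%O} -> {morph h : a / (~` a)%O} ->
  (forall a b, contact a b <-> contact (h a) (h b)) ->
  (forall a, bounded A a <-> bounded B (h a)) -> lca_isomorphic A B.
Proof.
move=> hbij hU hC hrho hbd.
have hI : {morph h : a b / (a `&` b)%O}.
  by move=> a b; apply: (can_inj complK); rewrite -hC !complI hU !hC.
exists h; split=> //.
- split=> //; first by rewrite -(meetxC \top%O) hI hC meetxC.
  by rewrite -(joinxC \bot%O) hU hC joinxC.
- have [g hK gK] := hbij; apply/seteqP; split=> [_ [a /hbd ba <-]//|b bb].
  by exists (g b); [apply/hbd; rewrite gK|rewrite gK].
Qed.

Lemma Psi_t_Psi_a d (A : lca d) : complete_lattice A ->
  lca_isomorphic (Psi_t (Psi_a A)) A.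
Proof.
move=> cA; apply: lca_isomorphic_sym; apply: (@lca_isomorphicI _ _ _ _ (@lambda_rc _ A)).
- have [g gK] := choice (lambda_rc_surj cA).
  by exists g => // a; apply: lambda_rc_inj; rewrite gK.
- by move=> a b; apply: rc_inj; exact: lambda_gU.
- by move=> a; apply: rc_inj; rewrite /= closure_lambda_gC.
- by move=> a b; split=> [/contact_cluster[s]|[s [sa sb]]];
    [exists s|apply/contact_cluster; exists s].
- by move=> a; split; [exact: compact_lambda_g|exact: lambda_g_bounded].
Qed.

Section HomeoTransport.
Context (S T : topologicalType) (f : S -> T) (g : T -> S).
Context (fc : continuous f) (gc : continuous g).
Context (fK : cancel f g) (gK : cancel g f).

Lemma preimage_homeo_closure (U : set T) : f @^-1` (closure U) = closure (f @^-1` U).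
Proof.
apply/seteqP; split=> x clx.
  move=> N Nx; have : nbhs (f x) (g @^-1` N) by apply: gc; rewrite fK.
  by move=> /clx[y [Uy Ny]]; exists (g y); rewrite /= gK.
move=> N /fc Nx; have [y [Uy Ny]] := clx _ Nx.
by exists (f y).
Qed.

Lemma preimage_homeo_interior (U : set T) : f @^-1` (U°) = (f @^-1` U)°.
Proof.
by apply: setC_inj; rewrite preimage_setC -!closure_setC preimage_homeo_closure.
Qed.

End HomeoTransport.

Lemma homeomorphic_Psi_t (S T : topologicalType) : homeomorphic S T ->
  lca_isomorphic (Psi_t T) (Psi_t S).
Proof.
move=> [f [g [fc gc fK gK]]].
have rcf (F : regular_closed T) : regclosed (f @^-1` F).
  rewrite /regclosed -(preimage_homeo_interior fc gc fK gK).
  by rewrite -(preimage_homeo_closure fc gc fK gK) rcP.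
have rcg (F : regular_closed S) : regclosed (g @^-1` F).
  rewrite /regclosed -(preimage_homeo_interior gc fc gK fK).
  by rewrite -(preimage_homeo_closure gc fc gK fK) rcP.
apply: (@lca_isomorphicI _ _ (Psi_t T) (Psi_t S) (fun F => RegularClosed (rcf F))).
- exists (fun F => RegularClosed (rcg F)) => F; apply: rc_inj => /=;
    by rewrite -comp_preimage; apply/seteqP; split=> x /=; rewrite ?gK ?fK.
- by move=> F G; exact: rc_inj.
- move=> F; apply: rc_inj => /=.
  by rewrite (preimage_homeo_closure fc gc fK gK).
- move=> F G; split=> [[y [Fy Gy]]|[x [Fx Gx]]]; last by exists (f x).
  by exists (g y); rewrite /= gK.
- have imgE (U V : Type) (h : U -> V) k : cancel h k -> cancel k h ->
      forall W : set V, h @^-1` W = k @` W.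
    move=> hK kK W; apply/seteqP; split=> [x Wx|_ [y Wy <-]]; last by rewrite /= kK.
    by exists (h x).
  have cpt (U V : topologicalType) (h : U -> V) (W : set U) : continuous h ->
      compact W -> compact (h @` W).
    by move=> hc; apply: continuous_compact; exact: continuous_subspaceT.
  move=> F /=; split=> cF; first by rewrite (imgE _ _ _ _ fK gK); exact: cpt.
  suff -> : (F : set T) = f @` (f @^-1` F) by exact: cpt.
  apply/seteqP; split=> [y Fy|_ [x Fx <-]//].
  by exists (g y); rewrite /= gK.
Qed.

(** * The contact algebra below an element *)

Section Relative.
Context d (A : lca d) (a0 : A).
Implicit Types (a : A) (b c : below a0).

Definition below_triple : lca_triple d :=
  @LcaTriple d (below a0)
    (fun b c => contact (below_val b) (below_val c)) (restr a0 @` bounded A).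

Lemma below_val_inj b c : below_val b = below_val c -> b = c.
Proof. exact: val_inj. Qed.

Lemma below_valC b : below_val (~` b)%O = (~` below_val b `&` a0)%O.
Proof. by []. Qed.

Lemma restr_val b : restr a0 (below_val b) = b.
Proof. by apply: below_val_inj; apply/meet_idPl; exact: belowP. Qed.

Lemma restrI a a' : restr a0 (a `&` a')%O = (restr a0 a `&` restr a0 a')%O.
Proof. by apply: below_val_inj; rewrite below_valI /= meetACA meetxx. Qed.

Lemma restrC a : restr a0 (~` a)%O = (~` restr a0 a)%O.
Proof.
by apply: below_val_inj; rewrite below_valC /= complI meetUl meetCx joinx0.
Qed.

Lemma restr_bot : restr a0 \bot%O = \bot%O.
Proof. by apply: below_val_inj; rewrite /= meet0x. Qed.

Lemma restr_top : restr a0 \top%O = \top%O.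
Proof. by apply: below_val_inj; rewrite /= meet1x. Qed.

Lemma restr_le a a' : (a <= a')%O -> (restr a0 a <= restr a0 a')%O.
Proof. by move=> aa'; rewrite below_leE /= leI2. Qed.

Lemma below_boundedP b : bounded below_triple b <-> bounded A (below_val b).
Proof.
split=> [[a ba <-]|bb]; first exact: bounded_down (leIl _ _) ba.
by exists (below_val b) => //; exact: restr_val.
Qed.

Lemma below_CrelE b c :
  @Crel _ below_triple b c <-> Crel (below_val b) (below_val c).
Proof.
by rewrite /Crel; split=> -[h|[hb hc]]; [left|right|left|right]; rewrite //;
  split=> /below_boundedP.
Qed.

(** Interpolation and density are inherited because [a << c] in the relative
    algebra means [a << c `|` ~` a0] in [A], so that witnesses found in [A] can be
    cut down to [a0]. *)
Lemma below_is_lca : is_lca below_triple.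
Proof.
have bot_neq b : b <> \bot%O -> below_val b <> \bot%O.
  by move=> b0 h; apply: b0; exact: below_val_inj.
split.
- split.
  + apply/below_boundedP; by case: (lca_ideal (lcaP A)).
  + move=> b c bc /below_boundedP hc; apply/below_boundedP.
    by apply: bounded_down hc; rewrite -below_leE.
  + move=> b c /below_boundedP hb /below_boundedP hc; apply/below_boundedP.
    exact: bounded_join.
- by move=> b /bot_neq /(lca_C1 (lcaP A)).
- by move=> b c /(lca_C2 (lcaP A))[b0 c0]; split=> h; [apply: b0|apply: c0]; rewrite h.
- by move=> b c /(lca_C3 (lcaP A)).
- by move=> a b c; exact: (lca_C4 (lcaP A)).
- move=> a c /below_boundedP ba.
  rewrite /way_below => nac.
  have wac : way_below (below_val a) (below_val c `|` ~` a0)%O.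
    by rewrite /way_below complU complK; exact: nac.
  have [b [bb ab bc]] := lca_BC1 (lcaP A) ba wac.
  exists (restr a0 b); split; first by exists b.
    move=> /= h; apply: ab; apply: contact_le h.
    rewrite -[X in (X <= _)%O]/(~` (b `&` a0) `&` a0)%O.
    by rewrite complI meetUl meetCx joinx0 leIl.
  move=> /(lca_C3 (lcaP A)) h; apply: bc; rewrite complU complK.
  by apply: (lca_C3 (lcaP A)); apply: contact_le h; exact: leIl.
- move=> b c /(lca_BC2 (lcaP A))[x [bx bxc]].
  exists (restr a0 x); split; first by exists x.
  by move: bxc; rewrite -{1}(meet_idPr (belowP c)) meetA.
- move=> b /bot_neq /(lca_BC3 (lcaP A))[x [bx x0 xb]].
  have xleb : (x <= below_val b)%O.
    rewrite -[below_val b]complK -disj_leC; apply/eqP; apply: contrapT.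
    move=> /(lca_C1 (lcaP A)) h; apply: xb.
    apply: contact_le (leIr _ x) _; apply: (lca_C3 (lcaP A)).
    by apply: contact_le (leIl x _) _; exact: h.
  have xa0 : (x <= a0)%O := le_trans xleb (belowP b).
  exists (Below xa0); split; first exact/below_boundedP.
    by move=> /(congr1 (@below_val _ _ _)).
  by move=> h; apply: xb; apply: contact_le h; exact: leIl.
Qed.

Definition below_lca : lca d := Lca below_is_lca.
Local Notation B := below_lca.

Lemma below_complete : complete_lattice A -> complete_lattice B.
Proof.
move=> cA S; have [m [mub mlub]] := cA (@below_val _ _ _ @` S).
have ma0 : (m <= a0)%O by apply: mlub => _ [b _ <-]; exact: belowP.
exists (Below ma0 : below a0); split=> b; first by move=> Sb; apply: mub; exists b.
by move=> bub; apply: mlub => _ [c Sc <-]; exact: bub.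
Qed.

(** * The dual of the restriction homomorphism *)

Lemma restr_preimage_ultra (u : bounded_ultrafilter B) :
  is_ultrafilter (restr a0 @^-1` u).
Proof.
have [[u1 uS uI] u0 _] := bultra_ultra u.
apply: filter_ultra.
- split=> [|a b ab|a b ua ub] /=.
  + by rewrite restr_top.
  + by apply: uS; exact: restr_le.
  + by rewrite restrI; exact: uI.
- by rewrite /= restr_bot.
- by move=> a /=; rewrite restrC; exact: (@ultra_compl _ B _ _ (bultra_ultra u)).
Qed.

Lemma restr_preimage_bounded (u : bounded_ultrafilter B) :
  is_bounded (restr a0 @^-1` u).
Proof.
have [b [ub /below_boundedP bb]] := bultra_bounded u.
by exists (below_val b); split=> //=; rewrite restr_val.
Qed.

Definition preimage_ultra (u : bounded_ultrafilter B) : bounded_ultrafilter A :=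
  BoundedUltrafilter (restr_preimage_ultra u) (restr_preimage_bounded u).

(** The right-hand side depends on [u] only through [sigma u]: this is why the
    dual map is well defined on clusters. *)
Lemma sigma_preimage (u : bounded_ultrafilter B) :
  bcluster_set (sigma (preimage_ultra u)) =
  [set a | forall b, bcluster_set (sigma u) b -> Crel a (below_val b)].
Proof.
have sub b : bcluster_set (sigma u) b ->
    bcluster_set (sigma (preimage_ultra u)) (below_val b).
  move=> sb a /= ua; have /below_CrelE := sb _ ua.
  by apply: Crel_le; exact: leIl.
apply/seteqP; split=> a.
  by move=> sa b /sub; exact: cluster_Crel.
move=> h b ub; apply: (Crel_le (leIl b a0)).
exact: h (restr a0 b) (@sub_sigma _ B u (bultra_ultra u) _ ub).
Qed.

(** The choice of an ultrafilter for [t] does not matter, by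
    [sigma_preimage]. *)
Definition restr_dual (t : Psi_a B) : Psi_a A :=
  sigma (preimage_ultra (projT1 (cid (cluster_sigma t)))).

Lemma restr_dualE (t : Psi_a B) : bcluster_set (restr_dual t) =
  [set a | forall b, bcluster_set t b -> Crel a (below_val b)].
Proof. by rewrite sigma_preimage -(projT2 (cid (cluster_sigma t))). Qed.

Lemma restr_dual_sigma (u : bounded_ultrafilter B) :
  restr_dual (sigma u) = sigma (preimage_ultra u).
Proof. by apply: bcluster_eq; rewrite restr_dualE sigma_preimage. Qed.

Lemma restr_dual_is_Psi_a_map :
  @is_Psi_a_map d d A B (restr a0) restr_dual.
Proof. by move=> u; rewrite restr_dual_sigma. Qed.

Lemma Psi_a_map_unique (f : Psi_a B -> Psi_a A) :
  @is_Psi_a_map d d A B (restr a0) f -> restr_dual = f.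
Proof.
move=> fP; apply/funext => t; have [u ->] := cluster_sigma t.
by apply: bcluster_eq; rewrite fP restr_dual_sigma.
Qed.

(** Maximality of [t] among sets of pairwise related elements gives the
    nontrivial inclusion. *)
Lemma restr_dual_below (t : Psi_a B) b :
  bcluster_set (restr_dual t) (below_val b) <-> bcluster_set t b.
Proof.
rewrite restr_dualE /=; split=> [h|tb c tc].
  by apply: cluster_max => c tc; apply/below_CrelE; exact: h.
by apply/below_CrelE; exact: (cluster_Crel tb tc).
Qed.

Lemma restr_dual_inj : injective restr_dual.
Proof.
move=> s t st; apply: bcluster_eq; apply/seteqP; split=> b.
  by move=> /restr_dual_below; rewrite st => /restr_dual_below.
by move=> /restr_dual_below; rewrite -st => /restr_dual_below.
Qed.

Lemma restr_dual_top (t : Psi_a B) : bcluster_set (restr_dual t) a0.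
Proof. by apply/(restr_dual_below t \top%O); exact: cluster_top. Qed.

(** A cluster containing [a0] contains an ultrafilter through [a0], and the
    trace of that ultrafilter below [a0] gives the preimage. *)
Lemma range_restr_dual : range restr_dual = lambda_g a0.
Proof.
apply/seteqP; split=> [_ [t _ <-]|s sa0]; first exact: restr_dual_top.
have [w [wa0 ws _]] := cluster_ultra sa0.
have [[w1 wS wI] w0 _] := bultra_ultra w.
pose u : set B := [set b : below a0 | bultra_set w (below_val b)].
have uu : is_ultrafilter u.
  apply: filter_ultra => //.
  - split=> // b c; last by move=> wb wc; exact: wI.
    by rewrite below_leE; exact: wS.
  - move=> b; case: (ultra_compl (below_val b) (bultra_ultra w)); first by left.
    by move=> wcb; right; exact: wI.
have ub : is_bounded u.
  have [x [wx bx]] := bultra_bounded w.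
  by exists (restr a0 x); split; [exact: wI|exists x].
exists (sigma (BoundedUltrafilter uu ub)) => //.
rewrite restr_dual_sigma; apply: sigma_sub_cluster => a /= wa.
by apply: ws; exact: wS (leIl _ _) wa.
Qed.

(** By normality the preimage of a basic closed set is the intersection of the
    [lambda_g (c `&` a0)] over all [c] such that [a] is not related to the
    complement of [c]. *)
Lemma restr_dual_continuous : continuous restr_dual.
Proof.
apply/continuous_closedP => C /Psi_a_closedP[S ->].
rewrite preimage_bigcap.
apply: closed_bigI => a _.
have -> : restr_dual @^-1` lambda_g a =
    \bigcap_(c in [set c | ~ Crel a (~` c)%O])
      lambda_g (restr a0 c : B) :> set (Psi_a B).
  apply/seteqP; split=> t ta.
    move=> c nac; apply: contrapT => ntc; apply: nac.
    have : bcluster_set t (restr a0 c `|` ~` restr a0 c)%O.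
      by rewrite joinxC; exact: cluster_top.
    case/cluster_join => // tcc.
    have : bcluster_set (restr_dual t) a := ta.
    rewrite restr_dualE => /(_ _ tcc).
    by rewrite -restrC; apply: Crel_le; exact: leIl.
  suff : bcluster_set (restr_dual t) a by [].
  rewrite restr_dualE => b tb; apply: contrapT.
  rewrite -[below_val b]complK => /Crel_normal[c [nac]]; rewrite complK; apply.
  apply: CrelC; apply: Crel_le (leIl _ a0) _; apply: CrelC.
  by apply/(below_CrelE (restr a0 c)); apply: (@cluster_Crel _ B t) tb; exact: ta.
by apply: closed_bigI => c _; exact: lambda_g_closed.
Qed.

Lemma restr_dual_closed : closed_map restr_dual.
Proof.
move=> C /Psi_a_closedP[S ->].
have -> : restr_dual @` (\bigcap_(b in S) lambda_g b) =
    lambda_g a0 `&` \bigcap_(b in S) lambda_g (below_val b) :> set (Psi_a A).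
  apply/seteqP; split=> [_ [t tS <-]|s []].
    split; first exact: restr_dual_top.
    by move=> b /tS tb; apply/restr_dual_below.
  rewrite -range_restr_dual => -[t _ <-] tS; exists t => // b /tS.
  by move=> /restr_dual_below.
apply: closedI; first exact: lambda_g_closed.
by apply: closed_bigI => b _; exact: lambda_g_closed.
Qed.

(** A nonempty basic open set, the complement of [lambda_g b], has an image
    containing the complement of [lambda_g (b `|` ~` a0)], which is nonempty
    because [b] is strictly below [a0]. *)
Lemma restr_dual_quasi_open : quasi_open restr_dual.
Proof.
move=> U [S ->] [t /existsNP[b /not_implyP[Sb ntb]]].
have [s ns] : exists s : Psi_a A, ~ bcluster_set s (below_val b `|` ~` a0)%O.
  apply: bcluster_avoid => h; apply: ntb.
  suff -> : b = \top%O by exact: cluster_top.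
  apply: below_val_inj; rewrite -[LHS](meet_idPl (belowP b)) /=.
  by rewrite -[LHS]joinx0 -(meetCx a0) -meetUl h meet1x.
exists s; apply: filterS (lambda_g_nbhs ns) => r nr.
have : range restr_dual r.
  rewrite range_restr_dual; apply: lambda_gC_sub => rC; apply: nr.
  exact: cluster_le (leUr _ _) rC.
move=> [p _ pr]; exists p => // pS; apply: nr; rewrite -pr.
apply: cluster_le (leUl _ _) _.
by apply/restr_dual_below; exact: pS.
Qed.

Lemma homeomorphic_lambda_g :
  homeomorphic (Psi_a B) (set_type (lambda_g a0 : set (Psi_a A))).
Proof.
set F : set (Psi_a A) := lambda_g a0.
have fF t : restr_dual t \in F by apply: mem_set; exact: restr_dual_top.
pose h t : set_type F := exist _ (restr_dual t) (fF t).
have hsurj (y : set_type F) : exists t, h t = y.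
  have : range restr_dual (set_val y) by rewrite range_restr_dual; exact: set_valP.
  by move=> [t _ ty]; exists t; exact: val_inj.
have [g gK] := choice hsurj.
have hK : cancel h g.
  by move=> t; apply: restr_dual_inj; have /(congr1 val) := gK (h t).
exists h, g; split=> //.
  apply: continuous_comp_initial; exact: restr_dual_continuous.
apply/continuous_closedP => C /restr_dual_closed cC.
have -> : g @^-1` C = set_val @^-1` (restr_dual @` C).
  apply/seteqP; split=> y /=.
    by move=> Cgy; exists (g y) => //; have /(congr1 val) := gK y.
  move=> [t Ct ty]; suff -> : g y = t by [].
  by rewrite -(hK t); congr g; exact: val_inj.
exact: (continuous_closedP _).1 (@initial_continuous _ _ set_val) _ cC.
Qed.

End Relative.

Theorem theorem4p9 (d : Order.disp_t) (A : lca d) (A_complete : complete_lattice A)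
    (a0 : A) :
  let X := Psi_a A in
  let F : set X := lambda_g a0 in
  let phi : A -> below a0 := restr a0 in
  let eta (a b : below a0) : Prop := contact (below_val a) (below_val b) in
  let Bt : lca_triple d := @LcaTriple d (below a0) eta (phi @` bounded A) in
  exists B_lca : is_lca Bt,
    let B : lca d := Lca B_lca in
    let G := Psi_a B in
    [/\ complete_lattice B,
        homeomorphic G (set_type F),
        lca_isomorphic (Psi_t (set_type F)) B,
        exists! f : G -> X, @is_Psi_a_map d d A B phi f &
        forall f : G -> X, @is_Psi_a_map d d A B phi f ->
          [/\ continuous f, closed_map f, quasi_open f, injective f &
              range f = F]].
Proof.
move=> X F phi eta Bt; exists (below_is_lca a0).
have cB := @below_complete d A a0 A_complete.
split.
- exact: cB.
- exact: homeomorphic_lambda_g.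
- apply: lca_isomorphic_trans (Psi_t_Psi_a cB).
  exact: homeomorphic_Psi_t (homeomorphic_lambda_g a0).
- exists (@restr_dual d A a0); split; first exact: restr_dual_is_Psi_a_map.
  by move=> f; exact: Psi_a_map_unique.
- move=> f /Psi_a_map_unique <-; split.
  + exact: restr_dual_continuous.
  + exact: restr_dual_closed.
  + exact: restr_dual_quasi_open.
  + exact: restr_dual_inj.
  + exact: range_restr_dual.
Qed.
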